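(* Let $d\ge 1$ and let $\mathbf{y}\in\mathbb{R}^{d(d+1)/2+1}$. Let $G$ be the weighted complete undirected graph on the vertex set $\{0,1,\dots,d,\infty\}$ with real edge weights determined by $\mathbf{y}$ as defined in the context. Then $\mathbf{C}_d^{\mathsf T}\mathbf{y}\ge\mathbf{0}$ if and only if the maximum weight of a $0$-$\infty$ cut in $G$ is at most $2y_1$, i.e. $$\max_{\substack{S\subseteq\{0,1,\dots,d,\infty\}\\ 0\in S,\ \infty\notin S}}\ \sum_{e\in\delta(S)}y_e\ \le\ 2y_1,$$ where $\delta(S)$ is the set of edges of $G$ with exactly one endpoint in $S$ and $y_e$ denotes the weight of the edge $e$.
   Context: $\mathbf{C}_d$ is the $(d(d+1)/2+1)\times 2^d$ matrix with $0$-$1$ entries whose columns are indexed by $\mathbf{k}=(k_1,\dots,k_d)\in\{0,1\}^d$ (ordered by increasing $\sum_j k_j$ and, within equal sums, in reverse lexicographic order) and whose rows are, in order: one row with entry $1$ in every column; then, for $i=1,\dots,d$, a row with entry $k_i$ in column $\mathbf{k}$; then, for pairs $1\le i<j\le d$ in lexicographic order, a row with entry $k_ik_j$ in column $\mathbf{k}$. Given $\mathbf{y}=(y_1,\dots,y_{d(d+1)/2+1})$, let $K_{d+1}$ be the complete undirected weighted graph on $\{0,1,\dots,d\}$ in which the edge $(0,i)$ has weight $y_{i+1}$, $i=1,\dots,d$, and the edges $(i,j)$, $1\le i<j\le d$, in lexicographic order, have weights $y_{d+2},\dots,y_{d(d+1)/2+1}$ respectively. For $i=0,\dots,d$ let $z_i$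 be minus the sum of the weights of all edges of $K_{d+1}$ incident with $i$. The graph $G$ is obtained from $K_{d+1}$ by adding a vertex $\infty$ and edges $(i,\infty)$ with weight $z_i$, $i=0,\dots,d$. *)

(* Defs.v *)
From HB Require Import structures.
From mathcomp Require Import all_boot all_order all_algebra.
From mathcomp Require Import reals.

Set Implicit Arguments.
Unset Strict Implicit.
Unset Printing Implicit Defensive.

Import Order.TTheory GRing.Theory Num.Theory.

Local Open Scope ring_scope.

(* Length of y, i.e. the number of rows of C_d. *)
Notation nrows d := ((d * d.+1)./2.+1)%N.

(* The pairs 1 <= i < j <= d, listed in lexicographic order. *)
Definition pairs (d : nat) : seq (nat * nat) :=
  [seq (i, j) | i <- iota 1 d, j <- iota i.+1 (d - i)].

(* The coordinate k_i of k = (k_1, ..., k_d), with i counted from 1. *)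
Definition bit (d : nat) (k : d.-tuple bool) (i : nat) : nat :=
  nth false k i.-1.

Definition bitsum (d : nat) (k : d.-tuple bool) : nat :=
  (\sum_(1 <= i < d.+1) bit k i)%N.

(* Column order: increasing sum, ties broken by decreasing lexicographic order,
   so that (1,0,0) precedes (0,1,0), which precedes (0,0,1). *)
Definition col_le (d : nat) : rel (d.-tuple bool) := fun k l =>
  (bitsum k < bitsum l)%N ||
  (bitsum k == bitsum l) && ((l : seqlexi bool) <= (k : seqlexi bool))%O.

Definition cols (d : nat) : seq (d.-tuple bool) :=
  sort (@col_le d) (enum {: d.-tuple bool}).

Definition rows (d : nat) : seq (d.-tuple bool -> nat) :=
  (fun=> 1%N)
    :: [seq (fun k => bit k i) | i <- iota 1 d]
    ++ [seq (fun k => (bit k p.1 * bit k p.2)%N) | p <- pairs d].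

(* The lists rows d and cols d have nrows d and 2 ^ d elements, so the default
   values of nth are never reached. *)
Definition Cmx (R : realType) (d : nat) : 'M[R]_(nrows d, 2 ^ d) :=
  \matrix_(r, c)
    (nth (fun=> 0%N) (rows d) r (nth [tuple of nseq d false] (cols d) c))%:R.

(* The coordinate y_m, with m counted from 1. *)
Definition coord1 (R : realType) (d : nat) (y : 'cV[R]_(nrows d)) (m : nat) : R :=
  y (inord m.-1) 0.

(* Edges of the complete graph on {0, ..., n-1}: an undirected edge is
   represented by the pair of its endpoints, the smaller one first. *)
Definition edges (n : nat) : {set 'I_n * 'I_n} :=
  [set e : 'I_n * 'I_n | (e.1 < e.2)%N].

(* Weight of the edge (i, j), i < j, of K_{d+1}. *)
Definition Kweight (R : realType) (d : nat) (y : 'cV[R]_(nrows d))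
    (i j : nat) : R :=
  if i == 0%N then coord1 y j.+1
  else coord1 y (d.+2 + index (i, j) (pairs d)).

Definition zweight (R : realType) (d : nat) (y : 'cV[R]_(nrows d))
    (i : nat) : R :=
  - \sum_(e in edges d.+1 | (e.1 == i :> nat) || (e.2 == i :> nat))
      Kweight y e.1 e.2.

(* The vertices 0, ..., d, oo of G are the elements of 'I_d.+2, the last one,
   ord_max, being oo. *)
Definition Gweight (R : realType) (d : nat) (y : 'cV[R]_(nrows d))
    (e : 'I_d.+2 * 'I_d.+2) : R :=
  if e.2 == ord_max then zweight y e.1 else Kweight y e.1 e.2.

Definition delta (n : nat) (S : {set 'I_n}) : {set 'I_n * 'I_n} :=
  [set e in edges n | (e.1 \in S) != (e.2 \in S)].

Definition cut_weight (R : realType) (d : nat) (y : 'cV[R]_(nrows d))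
    (S : {set 'I_d.+2}) : R :=
  \sum_(e in delta S) Gweight y e.

Definition zero_infty_cut (d : nat) (S : {set 'I_d.+2}) : bool :=
  (ord0 \in S) && (ord_max \notin S).

(* [set ord0] is a 0-oo cut, so this is the maximum over all 0-oo cuts. *)
Definition max_zero_infty_cut (R : realType) (d : nat) (y : 'cV[R]_(nrows d)) : R :=
  cut_weight y
    [arg max_(S > [set ord0] | zero_infty_cut S) cut_weight y S]%O.

(* Main.v *)
Require Import Defs.
From mathcomp Require Import all_boot all_order all_algebra.
From mathcomp Require Import reals.
From mathcomp Require Import zify ring lra.

Set Implicit Arguments.
Unset Strict Implicit.
Unset Printing Implicit Defensive.

Import Order.TTheory GRing.Theory Num.Theory.

Local Open Scope ring_scope.

(** Both sides of the equivalence are statements about the same quadratic function of k.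
    A column k of [Cmx R d] is a subset of {1, ..., d}; adding the vertex 0 turns
    it into a vertex set of the complete graph on {0, ..., d}, and these sets are
    exactly the sources of the cuts separating 0 from infinity.

    On the matrix side ([row_form]), the entry of the product at column k is y_1
    plus the total weight of the edges of the complete graph lying inside
    k with 0 added: the linear terms are the edges (0, i), the quadratic ones the
    edges (i, j).

    On the graph side ([cut_weightE]), for S not containing infinity,
    the edges to infinity contribute the sum of the z_i over i in S, that is minus
    the sum, over the edges e of the complete graph, of y_e times the number of
    endpoints of e in S ([sum_zweight]). An edge with one endpoint in S also
    crosses the cut itself, which cancels its contribution; an edge inside S does
    not cross the cut and is left with -2 y_e. So the cut has weight -2 times the weight of the edges inside S.

    Hence nonnegativity of the entry at k says exactly that the cut given by k has
    weight at most 2 y_1; ranging over all k gives the theorem. *)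

(** The indicator x of a vertex set is a function on nat, rather than a finite
    set, so that vertices of the complete graph, vertices of the larger graph and
    coordinates of a 0-1 vector can index it without casts. *)
Definition induced_weight (R : realType) (d : nat) (y : 'cV[R]_(nrows d))
    (x : nat -> bool) : R :=
  \sum_(e in edges d.+1) (x e.1 && x e.2)%:R * Kweight y e.1 e.2.

Definition add_zero (d : nat) (k : d.-tuple bool) (i : nat) : bool :=
  (i == 0%N) || nth false k i.-1.

Lemma eq_induced_weight (R : realType) (d : nat) (y : 'cV[R]_(nrows d))
    (x x' : nat -> bool) : {in gtn d.+1, x =1 x'} ->
  induced_weight y x = induced_weight y x'.
Proof. by move=> h; apply: eq_bigr => e _; rewrite !h ?inE. Qed.

Lemma big_edges (V : nmodType) (n : nat) (F : nat -> nat -> V) :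
  \sum_(e in edges n) F e.1 e.2 =
  \sum_(0 <= i < n) \sum_(i.+1 <= j < n) F i j.
Proof.
rewrite big_mkord (eq_bigr (fun i : 'I_n => \sum_(j < n | (i < j)%N) F i j)).
  by rewrite pair_big_dep; apply: eq_bigl => e; rewrite inE.
by move=> i _; rewrite big_geq_mkord.
Qed.

Lemma big_pairs (V : nmodType) (d : nat) (F : nat * nat -> V) :
  \sum_(p <- pairs d) F p =
  \sum_(1 <= i < d.+1) \sum_(i.+1 <= j < d.+1) F (i, j).
Proof.
rewrite big_allpairs_dep /= /index_iota subn1 /=.
by apply: eq_bigr => i _; rewrite subSS.
Qed.

Lemma mem_pairs (d i j : nat) :
  ((i, j) \in pairs d) = (1 <= i < j)%N && (j <= d)%N.
Proof.
apply/allpairsPdep/idP => [[a [b [ha hb [-> ->]]]]|h].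
  by move: ha hb; rewrite !mem_iota; lia.
by exists i, j; split=> //; rewrite mem_iota; lia.
Qed.

Lemma uniq_pairs (d : nat) : uniq (pairs d).
Proof.
apply: allpairs_uniq_dep => [|i _|]; try exact: iota_uniq.
by move=> [a b] [a' b'] _ _ /= [<- <-].
Qed.

Lemma size_pairs (d : nat) : (d.+1 + size (pairs d) = nrows d)%N.
Proof.
have -> : size (pairs d) = (\sum_(1 <= i < d.+1) (d - i))%N.
  rewrite size_allpairs_dep sumnE big_map /index_iota subn1 /=.
  by apply: eq_bigr => i _; rewrite size_iota.
rewrite big_add1 /= big_nat_rev /= addSn; congr _.+1.
rewrite (eq_big_nat _ _ (F2 := id)) => [|i hi]; last lia.
rewrite addnC -[X in (_ + X)%N]/(id d) -big_nat_recr //=.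
by rewrite bin2_sum bin2 /= mulnC.
Qed.

(** The rows of the matrix follow the order of the edge weights in y: row 0 gives
    y_1, rows 1, ..., d the edges at 0, and the remaining rows the edges (i, j)
    with i > 0, so the sum over rows is split at these two places. *)
Lemma row_form (R : realType) (d : nat) (y : 'cV[R]_(nrows d))
    (k : d.-tuple bool) :
  \sum_(r < nrows d) (nth (fun=> 0%N) (rows d) r k)%:R * y r 0 =
  coord1 y 1 + induced_weight y (add_zero k).
Proof.
rewrite (eq_bigr (fun r : 'I_(nrows d) =>
  (nth (fun=> 0%N) (rows d) r k)%:R * coord1 y r.+1)); last first.
  by move=> r _; rewrite /coord1 /= inord_val.
rewrite -(big_mkord xpredT (fun r =>
  (nth (fun=> 0%N) (rows d) r k)%:R * coord1 y r.+1)) -size_pairs.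
rewrite big_ltn //= mul1r; congr (_ + _).
rewrite /induced_weight.
rewrite (big_edges d.+1 (fun i j =>
  (add_zero k i && add_zero k j)%:R * Kweight y i j)).
(* Rows 1, ..., d against the edges whose smaller endpoint is 0. *)
rewrite (big_cat_nat _ (n := d.+1)) //=; last lia.
rewrite [RHS]big_ltn //=; congr (_ + _).
  apply: eq_big_nat => -[|i] // /andP[_]; rewrite ltnS => hi.
  rewrite /Kweight /= nth_cat size_map size_iota hi.
  by rewrite (nth_map 0%N) ?size_iota // nth_iota.
(* The remaining rows: the t-th of them belongs to the t-th pair, whose
   index in the list of pairs is t because that list has no repetition. *)
rewrite -(big_pairs d (fun p =>
  (add_zero k p.1 && add_zero k p.2)%:R * Kweight y p.1 p.2)).
rewrite (big_nth (0%N, 0%N)) -{1}[d.+1]add0n big_addn addKn.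
apply: eq_big_nat => t /andP[_ ht].
have := mem_nth (0%N, 0%N) ht.
rewrite addnS /= nth_cat size_map size_iota ifN; last lia.
rewrite addnK (nth_map (0%N, 0%N)) // /Kweight -surjective_pairing.
rewrite index_uniq ?uniq_pairs // addnC.
case: (nth _ _ t) => i j /=; rewrite mem_pairs => hij; rewrite /add_zero.
rewrite ifN; last lia.
have -> : (i == 0%N) = false by lia.
have -> : (j == 0%N) = false by lia.
by rewrite /bit mulnb.
Qed.

Lemma big_edges_recr (V : nmodType) (n : nat) (F : nat -> nat -> V) :
  \sum_(e in edges n.+1) F e.1 e.2 =
  \sum_(e in edges n) F e.1 e.2 + \sum_(0 <= i < n) F i n.
Proof.
rewrite !big_edges big_nat_recr //= [X in _ + X]big_geq // addr0 -big_split /=.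
by apply: eq_big_nat => i /andP[_ hi]; rewrite big_nat_recr.
Qed.

(** Double counting of incidences: the edge e occurs in z_i once for each of its
    endpoints i selected by x. *)
Lemma sum_zweight (R : realType) (d : nat) (y : 'cV[R]_(nrows d))
    (x : nat -> bool) :
  \sum_(0 <= i < d.+1) (x i)%:R * zweight y i =
  - \sum_(e in edges d.+1) ((x e.1)%:R + (x e.2)%:R) * Kweight y e.1 e.2.
Proof.
rewrite big_mkord.
under eq_bigr => i _ do rewrite /zweight mulrN big_distrr /= big_mkcondr /=.
rewrite sumrN; congr (- _); rewrite exchange_big /=.
apply: eq_bigr => e; rewrite inE => he; rewrite -big_mkcond /=.
have ne : e.2 != e.1 by rewrite -val_eqE /= gtn_eqF.
rewrite (bigD1 e.1) /= ?eqxx // (bigD1 e.2) /= ?eqxx ?orbT ?ne //.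
rewrite big1 ?addr0 ?mulrDl // => i; rewrite -!val_eqE /=; lia.
Qed.

(** With a and b the indicators of the endpoints of an edge of the complete
    graph, its total coefficient in the cut is (a xor b) - (a + b) = - 2 a b. *)
Lemma cut_weightE (R : realType) (d : nat) (y : 'cV[R]_(nrows d))
    (S : {set 'I_d.+2}) : ord_max \notin S ->
  cut_weight y S = - (2%:R * induced_weight y (fun i => inord i \in S)).
Proof.
move=> hS; pose x i := inord i \in S.
pose G i j := (x i != x j)%:R *
  (if j == d.+1 then zweight y i else Kweight y i j).
have -> : cut_weight y S = \sum_(e in edges d.+2) G e.1 e.2.
  rewrite /cut_weight /delta big_mkcond [RHS]big_mkcond /=.
  apply: eq_bigr => e _; rewrite !inE /G /x !inord_val /Gweight -val_eqE /=.
  by case: (_ < _)%N => //=; case: (_ != _); rewrite ?mul1r ?mul0r.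
have xmax : x d.+1 = false.
  by apply/negbTE; rewrite /x -[d.+1]/(val (@ord_max d.+1)) inord_val.
rewrite big_edges_recr.
have -> : \sum_(0 <= i < d.+1) G i d.+1 =
          \sum_(0 <= i < d.+1) (x i)%:R * zweight y i.
  by apply: eq_bigr => i _; rewrite /G eqxx xmax; case: (x i).
rewrite sum_zweight -sumrB /induced_weight big_distrr -sumrN /=.
apply: eq_bigr => e _; rewrite /G ifN; last by have := ltn_ord e.2; lia.
by rewrite -/(x e.1) -/(x e.2); case: (x e.1); case: (x e.2) => /=; ring.
Qed.

Lemma max_cut_leP (R : realType) (d : nat) (y : 'cV[R]_(nrows d)) (t : R) :
  max_zero_infty_cut y <= t <->
  (forall S : {set 'I_d.+2}, zero_infty_cut S -> cut_weight y S <= t).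
Proof.
rewrite /max_zero_infty_cut; case: arg_maxP => [|S hS maxS].
  by rewrite /zero_infty_cut !inE eqxx.
split=> [le_t S' hS'|]; last exact.
exact: le_trans (maxS S' hS') le_t.
Qed.

(** Every 0-1 vector occurs among the columns, so their order is irrelevant to
    the sign condition. *)
Lemma CmxTP (R : realType) (d : nat) (y : 'cV[R]_(nrows d)) :
  (forall c : 'I_(2 ^ d), 0 <= ((Cmx R d)^T *m y) c 0) <->
  (forall k : d.-tuple bool, 0 <= coord1 y 1 +
     induced_weight y (add_zero k)).
Proof.
have CE c : ((Cmx R d)^T *m y) c 0 = coord1 y 1 + induced_weight y
    (add_zero (nth [tuple of nseq d false] (cols d) c)).
  by rewrite -row_form mxE; apply: eq_bigr => r _; rewrite !mxE.
split=> [h k|h c]; last by rewrite CE.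
have kc : k \in cols d by rewrite mem_sort mem_enum.
have lt_c : (index k (cols d) < 2 ^ d)%N.
  rewrite (leq_trans (n := size (cols d))) ?index_mem //.
  by rewrite size_sort -cardE card_tuple card_bool.
by have := h (Ordinal lt_c); rewrite CE /= nth_index.
Qed.

Theorem mainTheorem6 (R : realType) (d : nat) (hd : (1 <= d)%N)
    (y : 'cV[R]_(nrows d)) :
  (forall k : 'I_(2 ^ d), 0 <= ((Cmx R d)^T *m y) k 0) <->
  max_zero_infty_cut y <= 2%:R * coord1 y 1.
Proof.
rewrite CmxTP max_cut_leP; split=> [h S /andP[S0 Sm]|h k].
  rewrite cut_weightE //.
  pose k := [tuple inord i.+1 \in S | i < d].
  have := h k.
  rewrite (@eq_induced_weight _ _ _ _ (fun i => inord i \in S)); first lra.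
  move=> [|i] hi; rewrite /add_zero /=.
    by rewrite -[0%N]/(val (@ord0 d.+1)) inord_val S0.
  by rewrite (nth_mktuple _ _ (Ordinal (hi : (i < d)%N))).
pose S := [set v : 'I_d.+2 | (v < d.+1)%N && add_zero k v].
have Sm : ord_max \notin S by rewrite inE /= ltnn.
have := h S; rewrite /zero_infty_cut Sm inE /= => /(_ isT).
rewrite cut_weightE // (@eq_induced_weight _ _ _ _ (add_zero k)); first lra.
move=> i hi; have {}hi : (i < d.+1)%N := hi.
by rewrite inE inordK ?hi // leqW.
Qed.
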